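(* Let $U$ be an open convex set in a normed space $X$. Then any nowhere dense subset of the boundary $\partial U$ (that is, any set $F\subset\partial U$ that is nowhere dense in the space $\partial U$) is $\ell$-miserable in $X$.
   Context: Normed spaces are over $\mathbb R$. $\partial U$ denotes the topological boundary of $U$ in $X$. A subset $V$ of a topological vector space $X$ is an $\ell$-neighborhood of a set $A\subset X$ if for any $a\in A$ and $v\in X$ there exists $\varepsilon>0$ such that $a+[0,\varepsilon)\cdot v\subset V$. A subset $A$ of $X$ is $\ell$-miserable if $A\subset\overline{X\setminus L}$ for some closed $\ell$-neighborhood $L$ of $A$ in $X$. *)

(* Defs.v *)
From HB Require Import structures.
From mathcomp Require Import all_boot all_order all_algebra.
From mathcomp Require Import all_classical all_reals all_analysis.

Set Implicit Arguments.
Unset Strict Implicit.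
Unset Printing Implicit Defensive.

Import Order.TTheory GRing.Theory Num.Theory.
Import numFieldNormedType.Exports.

Local Open Scope classical_set_scope.
Local Open Scope ring_scope.

Definition boundary (T : topologicalType) (A : set T) : set T :=
  closure A `\` interior A.

(* To speak of [F] being nowhere dense in a subspace [A] containing it, take
   [T] to be [subspace A].  That type keeps the points outside [A], as isolated
   points; when [F `<=` A] they do not lie in the closure of [F], so the closure
   and its interior are those computed in [A] with the induced topology. *)
Definition nowhere_dense (T : topologicalType) (F : set T) : Prop :=
  interior (closure F) = set0.
Arguments nowhere_dense : clear implicits.

Definition l_neighborhood (R : realType) (X : topologicalLmodType R)
    (A V : set X) : Prop :=
  forall a v : X, A a ->
    exists2 e : R, 0 < e & [set a + t *: v | t in `[0, e[] `<=` V.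

Definition l_miserable (R : realType) (X : topologicalLmodType R)
    (A : set X) : Prop :=
  exists L : set X,
    [/\ closed L, l_neighborhood A L & A `<=` closure (~` L)].

(* Main.v *)
Require Import Defs.
From HB Require Import structures.
From mathcomp Require Import all_boot all_order all_algebra.
From mathcomp Require Import all_classical all_reals all_analysis.
From mathcomp Require Import ring lra.

Import Order.TTheory GRing.Theory Num.Theory.
Import numFieldNormedType.Exports.

Local Open Scope classical_set_scope.
Local Open Scope ring_scope.

(** Remove from [X] the part of [U] that is much closer to the complement of
    [U] than to [F]: let [W] consist of the points of [U] at distance less than
    [r ^ 2] from some [b] outside [U] whose distance to [F] is at least [r],
    with [r <= 1/2], and let [L] be the complement of the open set [W].

    [L] is an l-neighborhood of [F] because [W] is thinner than any ray issued
    from a point [a] of [F].  A ray that stays outside [U] never meets [W].  If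
    the ray reaches a point [a + s *: v] of [U], then by convexity
    ([mem_convex_cone_ball]) the distance from [a + t *: v] to the complement
    of [U] is at least linear in [t], whereas membership of [a + t *: v] in
    [W] would make it at most quadratic in [t]
    ([thin_collar_avoids_short_segment]).

    [W] accumulates at every point of [F] because, [F] being nowhere dense in
    the boundary, every point of [F] is a limit of boundary points [b] at
    positive distance from [F] ([nowhere_dense_subspace_ball]), and each such
    [b] is a limit of points of [U], which are eventually in [W]. *)

Section ThinCollar.
Context {R : realType} {X : normedModType R}.
Implicit Types (U F : set X) (a b u v : X) (r s t l eta : R).

Lemma convex_set_comb U u a l : convex_set U -> U u -> U a ->
  0 <= l -> l <= 1 -> U (l *: u + (1 - l) *: a).
Proof.
move=> cU Uu Ua l0 l1.
by have := cU u a (Itv01 l0 l1); rewrite !inE => /(_ Uu Ua).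
Qed.

(** The point [a] can be replaced by a nearby [a'] in [U], the error being
    absorbed by moving [u] inside the open set [U]. *)
Lemma open_convex_comb_closure U u a l : open U -> convex_set U ->
  U u -> closure U a -> 0 < l -> l <= 1 -> U (l *: u + (1 - l) *: a).
Proof.
move=> oU cU Uu clUa l0 l1.
have /nbhs_ballP[e /= e0 ballU] : nbhs u U by exact: open_nbhs_nbhs.
have [a' [Ua']] := clUa (ball a (l * e)) (nbhsx_ballx _ _ (mulr_gt0 l0 e0)).
rewrite -ball_normE /= => aa'.
pose u' := u + l^-1 *: ((1 - l) *: (a - a')).
have Uu' : U u'.
  apply: ballU; rewrite -ball_normE /= /u' opprD addNKr normrN !normrZ.
  rewrite gtr0_norm ?invr_gt0// mulrC ltr_pdivrMr// [e * l]mulrC.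
  apply: le_lt_trans aa'; rewrite ler_piMl//.
  by rewrite ger0_norm ?subr_ge0//; lra.
have -> : l *: u + (1 - l) *: a = l *: u' + (1 - l) *: a'.
  rewrite /u' scalerDr scalerA mulfV ?gt_eqF// scale1r -addrA; congr (_ + _).
  by rewrite -scalerDr subrK.
by apply: convex_set_comb => //; exact: ltW.
Qed.

(** The homothety of centre [a] and ratio [t / s] maps the ball around
    [a + s *: v] to the ball of radius [t * (eta / s)] around [a + t *: v]. *)
Lemma mem_convex_cone_ball U a v b s t eta : open U -> convex_set U ->
  closure U a -> ball (a + s *: v) eta `<=` U -> 0 < t -> t <= s ->
  `|a + t *: v - b| < t * (eta / s) -> U b.
Proof.
move=> oU cU clUa ballU t0 ts bt.
have s0 : 0 < s := lt_le_trans t0 ts.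
pose c := a + (s / t) *: (b - a).
have Uc : U c.
  apply: ballU; rewrite -ball_normE /= /c.
  have -> : a + s *: v - (a + (s / t) *: (b - a)) =
            (s / t) *: (a + t *: v - b).
    rewrite opprD addrACA subrr add0r -scalerN opprB.
    have {1}-> : s = s / t * t by rewrite divfK ?gt_eqF.
    by rewrite -scalerA -scalerDr addrCA addrA.
  rewrite normrZ gtr0_norm ?divr_gt0// -ltr_pdivlMl ?divr_gt0//.
  by rewrite invf_div mulrAC -mulrA.
have -> : b = (t / s) *: c + (1 - t / s) *: a.
  rewrite /c scalerDr scalerA mulf_div [t * s]mulrC divff ?mulf_neq0 ?gt_eqF//.
  rewrite scale1r addrAC -scalerDl [t / s + _]addrC subrK.
  by rewrite scale1r addrC subrK.
apply: open_convex_comb_closure => //; first exact: divr_gt0.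
by rewrite ler_pdivrMr// mul1r.
Qed.

(** A union of balls indexed by their centre and the square root of their radius,
    which makes openness immediate and avoids distance functions to sets. *)
Definition thin_collar U F : set X :=
  U `&` \bigcup_(p in [set p : X * R | [/\ ~ U p.1, 0 < p.2, p.2 <= 2^-1 &
                                          ball p.1 p.2 `&` F = set0]])
          ball p.1 (p.2 ^+ 2).

Lemma open_thin_collar U F : open U -> open (thin_collar U F).
Proof.
by move=> oU; apply: openI => //; apply: bigcup_open => p _; exact: ball_open.
Qed.

(** Being close to [b] forces [r <= 2 * t * `|v|], so the distance from
    [a + t *: v] to [b] is less than [4 * t ^ 2 * `|v| ^ 2], which is below the
    linear bound of [mem_convex_cone_ball] once [t] is small. *)
Lemma thin_collar_avoids_short_segment U F a v : open U -> convex_set U ->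
  boundary U a -> F a ->
  exists2 e : R, 0 < e & forall t, 0 <= t -> t < e ->
    ~ thin_collar U F (a + t *: v).
Proof.
move=> oU cU [clUa]; rewrite (interior_id U).1// => nUa Fa.
have [[s s0 Us]|nUray] :=
  pselect (exists2 s, 0 < s & U (a + s *: v)); last first.
  exists 1 => // t; rewrite le_eqVlt => /predU1P[<-|t0] _ [Ut _].
    by apply: nUa; rewrite scale0r addr0 in Ut.
  by apply: nUray; exists t.
have /nbhs_ballP[eta /= eta0 ballU] : nbhs (a + s *: v) U.
  exact: open_nbhs_nbhs.
(* The linear and quadratic bounds cross at [t = eta / (4 * s * `|v| ^+ 2)];
   the added [1] covers [v = 0]. *)
set k := 4 * s * (`|v| ^+ 2 + 1).
have k0 : 0 < k by rewrite /k !mulr_gt0// ltr_wpDl// sqr_ge0.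
exists (Num.min s (eta / k)); first by rewrite lt_min s0 divr_gt0.
move=> t; rewrite le_eqVlt => /predU1P[<-|t0]; rewrite lt_min => /andP[ts tk].
  by case=> Ut _; apply: nUa; rewrite scale0r addr0 in Ut.
case=> _ [[b r] /= [nUb r0 r12 brF]]; rewrite -ball_normE /= => bt.
have rab : r <= `|b - a|.
  rewrite leNgt; apply/negP => bar.
  have : (ball b r `&` F) a by split; rewrite // -ball_normE.
  by rewrite brF.
have lin : t * (eta / s) <= `|a + t *: v - b|.
  rewrite leNgt; apply/negP => h; apply: nUb.
  by apply: mem_convex_cone_ball h => //; exact: ltW.
have tri : `|b - a| <= `|b - (a + t *: v)| + t * `|v|.
  have -> : t * `|v| = `|t *: v| by rewrite normrZ gtr0_norm.
  apply: le_trans (ler_normD _ _).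
  by rewrite opprD addrA subrK.
rewrite distrC in lin.
(* [r <= 1/2] lets half of [r] absorb the term [r ^+ 2] bounding the distance
   from [b] to [a + t *: v]. *)
have r2v : r <= 2 * (t * `|v|).
  have : r ^+ 2 <= 2^-1 * r by rewrite expr2 ler_wpM2r// ltW.
  lra.
have r2 : r ^+ 2 <= 4 * t ^+ 2 * `|v| ^+ 2.
  have : r ^+ 2 <= (2 * (t * `|v|)) ^+ 2.
    by rewrite ler_sqr ?nnegrE// ltW// (lt_le_trans r0).
  by rewrite !exprMn mulrA; congr (_ <= _ * _ * _); ring.
have quad : t * (eta / s) < 4 * t ^+ 2 * `|v| ^+ 2.
  by apply: lt_le_trans r2; exact: le_lt_trans lin bt.
move: tk; rewrite ltr_pdivlMr// => tk.
have : eta < t * k.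
  move: quad; rewrite mulrA ltr_pdivrMr// expr2 => quad.
  rewrite -(ltr_pM2l t0); apply: lt_le_trans quad _.
  rewrite /k; have : 0 <= t * t * s by rewrite !mulr_ge0// ltW.
  nra.
by move=> /(lt_trans tk); rewrite ltxx.
Qed.

(** Were the conclusion false, the trace on [A] of the ball of radius [e] around
    [a] would be a neighborhood of [a] in [A] contained in the closure of [F]. *)
Lemma nowhere_dense_subspace_ball (A : set X) F a e :
  A a -> F `<=` A -> nowhere_dense (subspace A) F -> 0 < e ->
  exists b r, [/\ A b, ball a e b, 0 < r & ball b r `&` F = set0].
Proof.
move=> Aa FA ndF e0.
apply: contrapT => h.
suff : interior (closure (F : set (subspace A))) a by rewrite ndF.
rewrite /interior /=; have : within A (nbhs a) (closure (F : set (subspace A))).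
  rewrite /within /=; apply: filterS (nbhsx_ballx a e e0) => b bae Ab B.
  rewrite /nbhs /= -nbhs_subspace_in// /within /= => /nbhs_ballP[r /= r0 brB].
  apply: contrapT => FB0; apply: h; exists b, r; split => //.
  rewrite -subset0 => y [bry Fy]; apply: FB0; exists y; split => //.
  by apply: brB => //; exact: FA.
by rewrite nbhs_subspace_in.
Qed.

(** A boundary point [b] of [U] near [a] with [ball b r] disjoint from [F] is the
    centre of one of the balls of the collar, and points of [U] come arbitrarily
    close to [b]. *)
Lemma closure_thin_collar U F : F `<=` boundary U -> open U ->
  nowhere_dense (subspace (boundary U)) F -> F `<=` closure (thin_collar U F).
Proof.
move=> FU oU ndF a Fa B /nbhs_ballP[e /= e0 aeB].
have [b [r [[clUb] + abe r0 brF]]] :=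
  nowhere_dense_subspace_ball _ _ _ _ (FU _ Fa) FU ndF e0.
rewrite (interior_id U).1// => nUb.
pose r' := Num.min r 2^-1.
have r'0 : 0 < r' by rewrite lt_min r0 invr_gt0 ltr0n.
have /clUb[u [Uu [bu au]]] : nbhs b (ball b (r' ^+ 2) `&` ball a e).
  apply: filterI; first by apply: nbhsx_ballx; rewrite exprn_gt0.
  by apply: open_nbhs_nbhs; split => //; exact: ball_open.
exists u; split; last exact: aeB.
split => //; exists (b, r') => //=; split => //.
  by rewrite ge_min lexx orbT.
rewrite -subset0 -brF; apply: setSI; apply: le_ball.
by rewrite ge_min lexx.
Qed.

End ThinCollar.

Theorem theorem1p6 (R : realType) (X : normedModType R) (U F : set X) :
  open U -> convex_set U ->
  F `<=` boundary U -> nowhere_dense (subspace (boundary U)) F ->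
  l_miserable F.
Proof.
move=> oU cU FU ndF; exists (~` thin_collar U F); split.
- exact/open_closedC/open_thin_collar.
- move=> a v Fa.
  have [e e0 avoid] :=
    thin_collar_avoids_short_segment _ _ _ v oU cU (FU _ Fa) Fa.
  exists e => // _ [t + <-]; rewrite /= in_itv /= => /andP[t0 te].
  exact: avoid.
- by rewrite setCK; exact: closure_thin_collar.
Qed.
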